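(* Let $(C_k)_{k\ge0}$, $(\Omega_k)_{k\ge0}$ be a nested tangent configuration with transition operators $G_k:\partial C_k\to\partial C_{k+1}$ (as defined in the context). Assume that: (1) the tangency points are isolated; (2) the transition operators $G_k$ admit, in geodesic coordinates $s$ centered at the tangency points, a uniform quadratic expansion $G_k(s)=\alpha_k s^2+o(s^2)$ with $\alpha_k>0$; (3) the dynamics near the tangency set decomposes into a finite number of branches (one local branch for each tangency region). Then, after the logarithmic change of variable $u=-\log|s|$, $s\ne0$, the dynamics $s_{k+1}=G_k(s_k)$ satisfies $$u_{k+1}=2u_k-\log\alpha_k+o(1),$$ where $u_k=-\log|s_k|$ and $o(1)$ denotes a term tending to $0$ as $s_k\to0$.
   Context: Everything takes place in $\mathbb{R}^2$. For a compact convex set $C$ with smooth boundary, $\nu_C(c)$ is the outward unit normal at $c\in\partial C$; $n_\Omega(x)$ is the inward unit normal to $\partial\Omega$ at $x$. Geometric normal property: an open set $\Omega\supset C$ satisfies the $C$-geometric normal property if (1) $C\subset\Omega$; (2) $\partial\Omega$ is $C^1$ outside $C$; (3) for any $c\in\partial C$ there is an outward normal ray $\Delta_c$ such that $\Delta_c\cap\Omega$ is connected; (4) for almost every $x\in\partial\Omega$, the inward normal ray starting at $x$ intersects $C$. Nested tangent configuration: sequences $C_0\supset C_1\supset C_2\supset\dots$ and $\Omega_0\subset\Omega_1\subset\Omega_2\subset\dots$ such that: each $C_k$ is a compact convex set with $C^3$ boundary and strictly positive curvature $\kappa_k>0$; each $\Omega_k$ is an open set containing $C_k$ with smooth boundary;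 each $\Omega_k$ satisfies the $C_k$-geometric normal property; all $\Omega_k$ are contained in a limiting domain $\Omega_\infty$; and for each $k$, $\partial C_{k+1}$ is tangent to $\partial C_k$ at least at one point. Tangency set: $T_k=\{c\in\partial C_k\cap\partial C_{k+1}:\nu_{C_k}(c)=\nu_{C_{k+1}}(c)\}$, and globally $T=\bigcup_k T_k$. Thickness function: $d_k(c)=\sup\{r\ge0: c+r\nu_{C_k}(c)\in\Omega_k\}$ for $c\in\partial C_k$. Radial map: $\Phi_{\Omega_k,C_k}(c)=c+d_k(c)\nu_{C_k}(c)\in\partial\Omega_k$. Reciprocal map: $\pi_{\Omega_k,C_{k+1}}$ sends $x\in\partial\Omega_k$ to the first intersection of the inward normal ray $\{x+t\,n_{\Omega_k}(x):t\ge0\}$ with $\partial C_{k+1}$. Transition operator: $G_k=\pi_{\Omega_k,C_{k+1}}\circ\Phi_{\Omega_k,C_k}:\partial C_k\to\partial C_{k+1}$. The dynamics is $c_{k+1}=G_k(c_k)$; near a tangency point, $s_k$ is the geodesic coordinate (signed arc length from the tangency point) of $c_k$ on $\partial C_k$, and the recursion is written $s_{k+1}=G_k(s_k)$. *)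

(* Defs.v *)
From HB Require Import structures.
From mathcomp Require Import all_boot all_order all_algebra.
From mathcomp Require Import all_classical all_reals all_analysis.
Set Implicit Arguments.
Unset Strict Implicit.
Unset Printing Implicit Defensive.
Import Order.TTheory GRing.Theory Num.Theory.
Import numFieldNormedType.Exports.
Local Open Scope classical_set_scope.
Local Open Scope ring_scope.

Section Plane.
Context {R : realType}.
Local Notation plane := (R * R)%type.
Implicit Types (C Om E A : set plane) (p c x y n v : plane).

(* The library norm on [R * R] is the sup norm; it induces the usual topology,
   but unit vectors and arc length need the Euclidean one. *)
Definition enorm v : R := Num.sqrt (v.1 ^+ 2 + v.2 ^+ 2).

Definition perp v : plane := (- v.2, v.1).

Definition boundary A : set plane := closure A `\` A°.

Definition ray x v : set plane := [set x + t *: v | t in [set t : R | 0 <= t]].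

Definition Cn_on (m : nat) (D : set R) (h : R -> R) : Prop :=
  (forall i t, (i < m)%N -> D t -> derivable (derive1n i h) t 1) /\
  (forall t, D t -> {for t, continuous (derive1n m h)}).

(* In the orthonormal frame [(perp n, n)] at [x], inside a small box, the set
   [E] is the region above the graph of [h].  Points on the graph itself are left
   unconstrained, so that the definition serves both open and closed sets; the
   graph is then exactly the boundary of [E] in the box.  Since [h] vanishes at
   [0] together with its derivative, [n] is the inward unit normal at [x]. *)
Definition local_graph E x n (h : R -> R) (r : R) : Prop :=
  [/\ 0 < r, enorm n = 1, h 0 = 0, derive1 h 0 = 0 &
      forall a b : R, `|a| < r -> `|b| < r ->
        (h a < b -> E (x + a *: perp n + b *: n)) /\
        (b < h a -> ~ E (x + a *: perp n + b *: n))].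

Definition Cn_boundary_at (m : nat) E x : Prop :=
  exists n h r, Cn_on m `]- r, r[ h /\ local_graph E x n h r.

Definition Cn_boundary (m : nat) E : Prop :=
  forall x, boundary E x -> Cn_boundary_at m E x.

Definition smooth_boundary E : Prop :=
  forall x, boundary E x ->
    exists n h r, (forall m, Cn_on m `]- r, r[ h) /\ local_graph E x n h r.

Definition is_inward_unit_normal E x n : Prop :=
  exists h r, Cn_on 1 `]- r, r[ h /\ local_graph E x n h r.

Definition inward_normal E x : plane := xget 0 (is_inward_unit_normal E x).
Definition outward_normal E x : plane := - inward_normal E x.

(* The curvature [h'' / (1 + h' ^ 2) ^ (3 / 2)] of the graph of [h], evaluated
   at [0] where [h' = 0]; it is positive when the boundary bends towards [E]. *)
Definition is_curvature E x (kappa : R) : Prop :=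
  exists n h r, [/\ Cn_on 2 `]- r, r[ h, local_graph E x n h r &
                    kappa = derive1n 2 h 0].

(* Null sets of the one-dimensional Hausdorff measure (length): such a set has
   countable covers by discs of arbitrarily small total radius. *)
Definition length_negligible A : Prop :=
  forall e : R, 0 < e -> exists (z : nat -> plane) (r : nat -> R),
    [/\ forall i, 0 <= r i,
        A `<=` \bigcup_i [set y | enorm (y - z i) <= r i] &
        forall N, \sum_(i < N) r i <= e].

Definition geometric_normal_property Om C : Prop :=
  [/\ C `<=` Om,
      forall x, boundary Om x -> ~ C x -> Cn_boundary_at 1 Om x,
      forall c, boundary C c -> exists v,
        is_inward_unit_normal C c (- v) /\ connected (ray c v `&` Om) &
      length_negligible [set x | boundary Om x /\
        ~ exists n, is_inward_unit_normal Om x n /\ ray x n `&` C !=set0]].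

Definition thickness Om C c : R :=
  sup [set r : R | 0 <= r /\ Om (c + r *: outward_normal C c)].

Definition radial_map Om C c : plane :=
  c + thickness Om C c *: outward_normal C c.

Definition reciprocal_map Om C x : plane :=
  x + inf [set t : R | 0 <= t /\ boundary C (x + t *: inward_normal Om x)]
      *: inward_normal Om x.

(* A unit speed parametrization, of either orientation, of the boundary of [C]
   that starts at [p]. *)
Definition arclength_parametrization C p (g : R -> plane) : Prop :=
  [/\ g 0 = p, range g = boundary C,
      forall t, derivable g t 1,
      continuous (derive1 g) & forall t, enorm (derive1 g t) = 1].

(* [g] is periodic; the signed arc length from [g 0] to a point of the curve is
   its parameter of least absolute value. *)
Definition geodesic_range (g : R -> plane) : set R :=
  [set s | forall t, g t = g s -> `|s| <= `|t|].

Definition geodesic_coordinate (g : R -> plane) c : R :=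
  xget 0 [set s | geodesic_range g s /\ g s = c].

Definition log_variable (s : R) : R := - ln `|s|.

Section Configuration.
Variables (C Om : nat -> set plane).

Definition tangency_set (k : nat) : set plane :=
  [set c | [/\ boundary (C k) c, boundary (C k.+1) c &
               outward_normal (C k) c = outward_normal (C k.+1) c]].

Definition global_tangency_set : set plane := \bigcup_k tangency_set k.

Definition nested_tangent_configuration (Om_lim : set plane) : Prop :=
  [/\ (forall k, C k.+1 `<=` C k) /\ (forall k, Om k `<=` Om k.+1),
      forall k, [/\ compact (C k), convex_set (C k), Cn_boundary 3 (C k) &
        forall c kappa, boundary (C k) c -> is_curvature (C k) c kappa ->
          0 < kappa],
      forall k, [/\ open (Om k), C k `<=` Om k, smooth_boundary (Om k) &
        geometric_normal_property (Om k) (C k)],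
      [/\ open Om_lim, connected Om_lim & forall k, Om k `<=` Om_lim] &
      forall k, tangency_set k !=set0].

Definition transition (k : nat) c : plane :=
  reciprocal_map (Om k) (C k.+1) (radial_map (Om k) (C k) c).

(* The (co)domains of the radial map and of the transition operators.  They rule
   out the default values of [sup], [inf] and [xget]: the thickness is finite,
   and the inward normal ray does meet the boundary of [C k.+1]. *)
Definition transitions_well_defined : Prop :=
  forall k c, boundary (C k) c ->
    boundary (Om k) (radial_map (Om k) (C k) c) /\
    boundary (C k.+1) (transition k c).

(* Dynamics near the tangency set: a neighbourhood of it splits into finitely
   many disjoint regions; a region contains at most one tangency point of each
   step, and is preserved by the transition operator at the steps where it
   contains one. *)
Definition finitely_many_branches : Prop :=
  exists (N : nat) (U : 'I_N -> set plane),
    [/\ (forall j, open (U j)) /\ trivIset setT U,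
        global_tangency_set `<=` \bigcup_j U j,
        forall j, U j `&` global_tangency_set !=set0,
        forall j k p q, (tangency_set k `&` U j) p ->
          (tangency_set k `&` U j) q -> p = q &
        forall j k, tangency_set k `&` U j !=set0 ->
          forall c, boundary (C k) c -> U j c -> U j (transition k c)].

(* [g k p] parametrizes the boundary of [C k] from the tangency point [p]. *)
Definition geodesic_parametrizations (g : nat -> plane -> R -> plane) : Prop :=
  forall k p, global_tangency_set p -> boundary (C k) p ->
    arclength_parametrization (C k) p (g k p).

Section Coordinates.
Variable g : nat -> plane -> R -> plane.

(* The operator [transition k] read in the geodesic coordinates of the boundaries
   of [C k] and [C k.+1], both centered at the tangency point [p]. *)
Definition local_transition (k : nat) p (s : R) : R :=
  geodesic_coordinate (g k.+1 p) (transition k (g k p s)).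

(* The remainder is [o(s ^ 2)] uniformly in the step and the tangency point; no
   uniform lower bound on the coefficients is assumed. *)
Definition uniform_quadratic_expansion (alpha : nat -> plane -> R) : Prop :=
  (forall k p, tangency_set k p -> 0 < alpha k p) /\
  forall e : R, 0 < e -> exists2 d : R, 0 < d &
    forall k p s, tangency_set k p -> geodesic_range (g k p) s -> `|s| < d ->
      `|local_transition k p s - alpha k p * s ^+ 2| <= e * s ^+ 2.

End Coordinates.
End Configuration.
End Plane.

(* Main.v *)
Require Import Defs.
From HB Require Import structures.
From mathcomp Require Import all_boot all_order all_algebra.
From mathcomp Require Import all_classical all_reals all_analysis.
From mathcomp Require Import ring lra.
Set Implicit Arguments.
Unset Strict Implicit.
Unset Printing Implicit Defensive.
Import Order.TTheory GRing.Theory Num.Theory.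
Import numFieldNormedType.Exports.
Local Open Scope classical_set_scope.
Local Open Scope ring_scope.

(** Write the expansion as [s' = alpha * s ^+ 2 * q], where the relative factor
    [q] differs from [1] by at most [e / alpha].  Taking logarithms turns the
    product into the sum
    [- ln s' = - 2 * ln `|s| - ln alpha - ln q],
    so the error of the recursion is exactly [- ln q], which is small because
    [ln] is continuous at [1] and vanishes there ([near_1_small_ln],
    [log_variable_step]).  A lower bound [a] on the coefficients makes
    [q - 1] uniformly small ([uniform_log_recursion]).

    The expansion only speaks of parameters that are geodesic coordinates, that
    is, of least absolute value among the parameters of the same point.  For the
    limit at a single step one therefore needs every small parameter to be one.
    This holds since a continuously differentiable curve of unit speed has a
    coordinate whose derivative does not vanish at [0], and is injective near
    [0] by Rolle's theorem ([near_injective], [near0_geodesic_range]). *)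

Lemma near_1_small_ln (R : realType) (eta : R) : 0 < eta ->
  exists2 e : R, 0 < e &
    forall q, `|q - 1| <= e -> 0 < q /\ `|ln q| < eta.
Proof.
move=> eta0; have /cvgrPdist_lt/(_ _ eta0) := continuous_ln (@ltr01 R).
move=> /nbhs_ballP[d /= d0 dP].
exists (Num.min (d / 2) (1 / 2)); first by rewrite lt_min !divr_gt0.
move=> q; rewrite le_min => /andP[qd]; rewrite ler_norml => /andP[q1 _].
split; first by lra.
have := dP q; rewrite ln1 sub0r normrN; apply.
by rewrite /ball /= distrC; lra.
Qed.

(** The point of the change of variable: it turns a relative error on the
    quadratic model into an additive error, of the size of a logarithm near
    [1]. *)
Lemma log_variable_step (R : realType) (alpha s q : R) :
  0 < alpha -> s != 0 -> 0 < q ->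
  log_variable (alpha * s ^+ 2 * q) - (2 * log_variable s - ln alpha) = - ln q.
Proof.
move=> a0 s0 q0; have s20 : 0 < s ^+ 2 by rewrite exprn_even_gt0.
have lns2 : ln (s ^+ 2) = 2 * ln `|s|.
  by rewrite -(real_normK (num_real s)) lnXn ?normr_gt0// mulr_natl.
move: (s ^+ 2) s20 lns2 => s2 s20 lns2.
rewrite /log_variable gtr0_norm ?mulr_gt0//.
by rewrite !lnM ?posrE ?mulr_gt0// lns2; ring.
Qed.

(** The uniform quadratic remainder is absolute, hence its quotient by the
    leading term [alpha k p * s ^+ 2] is uniform only over the coefficients
    bounded below by [a]. *)
Lemma uniform_log_recursion (R : realType) (C Om : nat -> set (R * R))
    (g : nat -> R * R -> R -> R * R) (alpha : nat -> R * R -> R) (a eta : R) :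
  uniform_quadratic_expansion C Om g alpha -> 0 < a -> 0 < eta ->
  exists2 d : R, 0 < d &
    forall k p s, tangency_set C k p -> a <= alpha k p ->
      geodesic_range (g k p) s -> 0 < `|s| < d ->
      local_transition C Om g k p s != 0 /\
      `|log_variable (local_transition C Om g k p s)
          - (2 * log_variable s - ln (alpha k p))| < eta.
Proof.
move=> [_ expansion] a0 /near_1_small_ln[e e0 eP].
have [d d0 dP] := expansion _ (mulr_gt0 a0 e0); exists d => // k p s kp a_le gs.
rewrite normr_gt0 => /andP[s0 sd]; move: (dP _ _ _ kp gs sd).
move: (local_transition C Om g k p s) (alpha k p) a_le => L al a_le Lle.
have al0 : 0 < al by apply: lt_le_trans a_le.
have s20 : 0 < s ^+ 2 by rewrite exprn_even_gt0.
have m0 : 0 < al * s ^+ 2 by rewrite mulr_gt0.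
have LE : L = al * s ^+ 2 * (L / (al * s ^+ 2)).
  by rewrite mulrC divfK// gt_eqF.
have [|q0 lnq] := eP (L / (al * s ^+ 2)).
  have -> : L / (al * s ^+ 2) - 1 = (L - al * s ^+ 2) / (al * s ^+ 2).
    by rewrite mulrBl divff// gt_eqF.
  rewrite normrM normfV (gtr0_norm m0) ler_pdivrMr//.
  by apply: (le_trans Lle); rewrite [leRHS]mulrA (mulrC e) !ler_pM2r.
split; first by rewrite LE mulf_neq0// gt_eqF.
by rewrite LE log_variable_step// normrN.
Qed.

Lemma near_injective (R : realType) (f f' : R -> R) (x : R) :
  (forall t : R, is_derive t (1 : R) f (f' t)) -> {for x, continuous f'} -> f' x != 0 ->
  exists2 d : R, 0 < d &
    forall s t, `|s - x| < d -> `|t - x| < d -> f s = f t -> s = t.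
Proof.
move=> df cf' f'x.
have /nbhs_ballP[d /= d0 dP] : \forall t \near x, f' t != 0.
  exact: (cvgr_neq0 _ cf' f'x).
exists d => // s t sd td; wlog st : s t sd td / s < t => [hw fst|fst].
  have [st|ts|//] := ltgtP s t; first exact: hw.
  by apply/esym/hw.
have [|||c] := @Rolle _ f _ _ st.
- by move=> y _; apply: ex_derive.
- apply: derivable_within_continuous => y _; exact: ex_derive.
- by [].
move=> /itvP cst dc.
have /negP[] : f' c != 0.
  apply: dP; rewrite /ball /= distrC ltr_distl.
  move: sd td; rewrite !ltr_distl => /andP[sd _] /andP[_ td].
  by rewrite (lt_trans sd) ?cst// (lt_trans _ td) ?cst.
by rewrite -(@derive_val _ _ _ _ _ _ _ (df c)) (@derive_val _ _ _ _ _ _ _ dc).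
Qed.

(** A continuous linear form commutes with the difference quotients defining the
    derivative; used for the two coordinates of a plane curve. *)
Lemma is_derive_linear_comp (R : realType) (V W : normedModType R)
    (l : {linear V -> W}) (g : R -> V) (t : R) :
  continuous l -> derivable g t 1 -> is_derive t (1 : R) (l \o g) (l (derive1 g t)).
Proof.
move=> cl dg.
have lim : h^-1 *: ((l \o g) (h *: 1 + t) - (l \o g) t) @[h --> (0 : R)^']
    --> l (derive1 g t).
  rewrite derive1E.
  under eq_fun do rewrite /= -linearB -linearZ.
  exact: (continuous_cvg _ (cl _) dg).
by split; [apply/cvg_ex; exists (l (derive1 g t)) | apply: cvg_lim].
Qed.

(** Two parameters of the same point near [0] coincide, hence the first of them
    has the least absolute value. *)
Lemma near0_geodesic_range (R : realType) (C : set (R * R)) (p : R * R)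
    (g : R -> R * R) :
  arclength_parametrization C p g -> \forall s \near (0 : R), geodesic_range g s.
Proof.
move=> [_ _ dg cg' unit].
have [d d0 inj] : exists2 d : R, 0 < d &
    forall s t, `|s| < d -> `|t| < d -> g s = g t -> s = t.
  have coord (l : {linear (R * R)%type -> R}) :
      continuous l -> l (derive1 g 0) != 0 -> exists2 d : R, 0 < d &
      forall s t, `|s| < d -> `|t| < d -> g s = g t -> s = t.
    move=> cl l0; have [|||d d0 dP] := @near_injective _ (l \o g) (l \o derive1 g) 0.
    - by move=> t; apply: is_derive_linear_comp.
    - by apply: continuous_comp; [apply: cg' | apply: cl].
    - by [].
    exists d => // s t sd td gst; apply: dP; rewrite ?subr0//=.
    by rewrite gst.
  have [g10|] := eqVneq (derive1 g 0).1 0; last first.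
    by apply: (coord fst) => x; apply: cvg_fst.
  apply: (coord snd) => [x|]; first exact: cvg_snd.
  apply/eqP => g20; have := unit 0.
  rewrite /enorm g10 [X in _ + X ^+ 2]g20 expr0n addr0 sqrtr0 => /esym/eqP.
  by rewrite oner_eq0.
apply/nbhs_ballP; exists d => //= s; rewrite /ball /= sub0r normrN => sd t gts.
rewrite leNgt; apply/negP => ts.
by have := ts; rewrite (inj t s _ sd gts) ?ltxx// (lt_trans ts).
Qed.

(* The first conclusion is the recursion with, at each step, an error tending to
   0 as s_k -> 0; the second one says that this error is uniform over all the
   steps and tangency points at which the coefficients stay away from 0. *)
Theorem theorem12p1 (R : realType) (C Om : nat -> set (R * R))
    (Om_lim : set (R * R)) (g : nat -> R * R -> R -> R * R)
    (alpha : nat -> R * R -> R) :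
  nested_tangent_configuration C Om Om_lim ->
  transitions_well_defined C Om ->
  geodesic_parametrizations C g ->
  global_tangency_set C `<=` isolated (global_tangency_set C) ->
  uniform_quadratic_expansion C Om g alpha ->
  finitely_many_branches C Om ->
  (forall k p, tangency_set C k p ->
    log_variable (local_transition C Om g k p s)
      - (2 * log_variable s - ln (alpha k p)) @[s --> (0 : R)^'] --> (0 : R)) /\
  (forall a eta : R, 0 < a -> 0 < eta -> exists2 d : R, 0 < d &
    forall (s : nat -> R) k p, tangency_set C k p -> a <= alpha k p ->
      geodesic_range (g k p) (s k) -> 0 < `|s k| < d ->
      s k.+1 = local_transition C Om g k p (s k) ->
      s k.+1 != 0 /\
      `|log_variable (s k.+1) - (2 * log_variable (s k) - ln (alpha k p))|
        < eta).
Proof.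
move=> _ _ arcs _ expansion _; split=> [k p kp|a eta a0 eta0]; last first.
  have [d d0 dP] := uniform_log_recursion expansion a0 eta0.
  by exists d => // s k p kp a_le gs sd ->; apply: dP.
have /near0_geodesic_range small : arclength_parametrization (C k) p (g k p).
  by apply: arcs; [exists k | case: kp].
apply/cvgrPdist_lt => eta eta0.
have [d d0 dP] := uniform_log_recursion expansion (expansion.1 _ _ kp) eta0.
near=> s; rewrite sub0r normrN; apply: (dP _ _ _ kp (lexx _) _ _).2.
  by near: s; apply: nbhs_dnbhs.
apply/andP; split; first by rewrite normr_gt0; near: s; apply: nbhs_dnbhs_neq.
by near: s; apply: dnbhs0_lt.
Unshelve. all: by end_near. Qed.
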